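(* Let $R$ be a ring, let $M$ be a left $R$-module and let $T$ be a maximal submodule of $M$. The following conditions are equivalent: (1) $|G(M)|$ is infinite and $\deg(T)<|G(M)|$; (2) there are submodules $S$ and $S'$ of $M$ such that all of the following hold: (i) $S$ is simple and $M=S\oplus T$; (ii) $S'$ is a simple submodule of $T$, $S'$ is essential in $T$, and $S\simeq S'$; (iii) $|\mathrm{End}(S)|=|G(M)|$ is infinite; (iv) $|G(M/S')|+1<|G(M)|$.
   Context: Rings are associative with unity and modules are unitary left modules. A nontrivial submodule of $M$ is a submodule different from $0$ and $M$. The intersection graph $G(M)$ is the simple graph whose vertices are the nontrivial submodules of $M$, two distinct vertices being adjacent iff their intersection is nonzero; $|G(M)|$ is the cardinality of its vertex set. For a submodule $N$ of $M$, $\deg(N)$ is the cardinality of the set of all nontrivial submodules $K\neq N$ of $M$ with $N\cap K\neq 0$ (the degree of $N$ in $G(M)$). A submodule is essential if it intersects every nonzero submodule nontrivially. $\mathrm{End}(S)$ is the ring of $R$-endomorphisms of $S$. Inequalities and sums are of cardinal numbers. *)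

(* Defs.v *)
From HB Require Import structures.
From mathcomp Require Import all_boot all_algebra.
From mathcomp Require Import boolp classical_sets functions cardinality.

Set Implicit Arguments.
Unset Strict Implicit.
Unset Printing Implicit Defensive.

Import GRing.Theory.

Local Open Scope ring_scope.
Local Open Scope quotient_scope.
Local Open Scope classical_set_scope.
Local Open Scope card_scope.

(* Rings are [pzRingType]s: associative, unital, possibly zero and possibly
   noncommutative; a left module over R is an [lmodType R].  A submodule of M is
   an element of [submodClosed M], a predicate together with its closure
   proofs; by [submod_ext] two submodules are equal iff they have the same
   elements, so that cardinalities of sets of submodules are the intended ones. *)

Section Submodules.
Variables (R : pzRingType) (M : lmodType R).
Implicit Types N K : submodClosed M.

Lemma submod_ext N K : N =i K -> N = K.
Proof.
case: N => f [[f1] [f2]]; case: K => g [[g1] [g2]] fg.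
have e : f = g by apply/funext => x; have := fg x.
subst g; congr (GRing.SubmodClosed.Pack (GRing.SubmodClosed.Class _ _)).
- by congr GRing.isAddClosed.Axioms_; exact: Prop_irrelevance.
- by congr GRing.isScaleClosed.Axioms_; exact: Prop_irrelevance.
Qed.

Definition is_zero (A : {pred M}) := A =i pred1 0.
Definition is_full (A : {pred M}) := A =i predT.

Definition nontrivial N := ~ is_zero N /\ ~ is_full N.

Definition maximal_submod N :=
  ~ is_full N /\
  forall K, {subset N <= K} -> K = N \/ is_full K.

Definition essential_in N K :=
  {subset N <= K} /\
  forall L : submodClosed M, {subset L <= K} -> ~ is_zero L ->
    ~ is_zero [predI N & L].

Definition direct_sum N K :=
  is_zero [predI N & K] /\
  forall x : M, exists u v : M, [/\ u \in N, v \in K & x = u + v].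

(* The submodule N as a module of its own. *)
Record submod_type N := SubmodElt {
  submod_val :> M;
  _ : submod_val \in N
}.

HB.instance Definition _ N := [isSub for @submod_val N].
HB.instance Definition _ N := [Choice of submod_type N by <:].
HB.instance Definition _ N :=
  GRing.SubChoice_isSubLmodule.Build R M [in N] (submod_type N)
    (submodClosedP N).

End Submodules.

(* [submodClosed] does not record closure under opposite, which the quotient
   construction of the library requires. *)
Section QuotientModule.
Variables (R : pzRingType) (M : lmodType R) (N : submodClosed M).

Definition submod_pred : M -> bool := fun x => x \in N.

Fact submod_pred_zmod : zmod_closed submod_pred.
Proof. exact: GRing.submod_closedB (submodClosedP N). Qed.

Definition submod_zmodClosed : zmodClosed M :=
  HB.pack_for (zmodClosed M) submod_pred
    (GRing.isZmodClosed.Build M submod_pred submod_pred_zmod).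

Definition quotmod := Quotient.quot submod_zmodClosed.

HB.instance Definition _ := GRing.Zmodule.on quotmod.
HB.instance Definition _ := EqQuotient.on quotmod.

Definition quotmod_scale (a : R) (x : quotmod) : quotmod :=
  \pi_quotmod (a *: repr x).

Lemma quotmod_piE (x y : M) :
  (\pi_quotmod x = \pi_quotmod y) <-> (x - y \in N).
Proof.
have -> : (x - y \in N) = (x == y %[mod quotmod]).
  exact: (@Quotient.idealrBE M submod_zmodClosed x y).
by split=> /eqP.
Qed.

Lemma quotmod_piD (x y : M) :
  \pi_quotmod (x + y) = \pi_quotmod x + \pi_quotmod y.
Proof. exact: (@Quotient.pi_add M submod_zmodClosed). Qed.

Lemma quotmod_piZ a (x : M) :
  \pi_quotmod (a *: x) = quotmod_scale a (\pi_quotmod x).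
Proof.
apply/quotmod_piE; rewrite -scalerBr rpredZ//.
by apply/quotmod_piE; rewrite reprK.
Qed.

Fact quotmod_scaleA a b x :
  quotmod_scale a (quotmod_scale b x) = quotmod_scale (a * b) x.
Proof.
rewrite -[x]reprK -(quotmod_piZ b) -(quotmod_piZ a) -(quotmod_piZ (a * b)).
by rewrite scalerA.
Qed.

Fact quotmod_scale1 : left_id 1 quotmod_scale.
Proof. by move=> x; rewrite -[x]reprK -quotmod_piZ scale1r. Qed.

Fact quotmod_scaleDr : right_distributive quotmod_scale +%R.
Proof.
move=> a x y; rewrite -[x]reprK -[y]reprK -quotmod_piD -!(quotmod_piZ a).
by rewrite scalerDr quotmod_piD.
Qed.

Fact quotmod_scaleDl x : {morph quotmod_scale^~ x : a b / a + b}.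
Proof.
move=> a b; rewrite -[x]reprK -(quotmod_piZ (a + b)) -(quotmod_piZ a).
by rewrite -(quotmod_piZ b) scalerDl quotmod_piD.
Qed.

HB.instance Definition _ := GRing.Zmodule_isLmodule.Build R quotmod
  quotmod_scaleA quotmod_scale1 quotmod_scaleDr quotmod_scaleDl.

End QuotientModule.

Definition simple_module (R : pzRingType) (U : lmodType R) :=
  (exists u : U, u != 0) /\
  forall N : submodClosed U, is_zero N \/ is_full N.

Definition module_iso (R : pzRingType) (U V : lmodType R) :=
  exists f : {linear U -> V}, bijective f.

(* The underlying set of the ring End(U). *)
Definition End_set (R : pzRingType) (U : lmodType R) : set {linear U -> U} :=
  [set: {linear U -> U}].
Arguments End_set {R} U.

Lemma linear_ext (R : pzRingType) (U V : lmodType R) (f g : {linear U -> V}) :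
  f =1 g -> f = g.
Proof.
case: f => f [[f1] [f2]]; case: g => g [[g1] [g2]] /= fg.
have e : f = g by apply/funext.
subst g; congr (GRing.Linear.Pack (GRing.Linear.Class _ _)).
- by congr Algebra.isNmodMorphism.Axioms_; exact: Prop_irrelevance.
- by congr GRing.isScalable.Axioms_; exact: Prop_irrelevance.
Qed.

Section IntersectionGraph.
Variables (R : pzRingType) (M : lmodType R).

Definition ig_vertices : set (submodClosed M) := [set N | nontrivial N].

Definition ig_adj (N K : submodClosed M) :=
  N <> K /\ ~ is_zero [predI N & K].

(* The set whose cardinality is deg(N). *)
Definition ig_neighbours (N : submodClosed M) : set (submodClosed M) :=
  [set K | ig_vertices K /\ ig_adj N K].

End IntersectionGraph.

Arguments ig_vertices {R} M.

Definition card_lt (T U : Type) (A : set T) (B : set U) : Prop :=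
  A #<= B /\ ~ (B #<= A).

(* A set of cardinality |A| + 1. *)
Definition add_point (T : Type) (A : set T) : set (option T) :=
  None |` (Some @` A).

(* Main.v *)
(* (1) => (2): a vertex that is neither T nor a neighbour of T is a complement of
   T, so T has |G(M)| complements K, each of them simple.  If L and L' are
   nonzero submodules of T, then K |-> (K + L, K + L') is injective as soon as
   L and L' meet trivially, so that |G(M)| <= deg(T)^2; since deg(T) < |G(M)| is
   infinite, this is absurd and T is uniform.  Fix a complement S.  A second one
   is the graph of a nonzero linear map S -> T, whose image S' is thus simple and
   essential in T.  Every complement is the graph of a map S -> S', so there are
   |End(S)| of them.  In both directions, the submodules of M meeting T
   nontrivially are those containing S', so that deg(T) is compared with
   |G(M/S')| + 1. *)
From HB Require Import structures.
Require Import Defs.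
From mathcomp Require Import all_boot all_algebra.
From mathcomp Require Import boolp classical_sets functions cardinality.

Set Implicit Arguments.
Unset Strict Implicit.
Unset Printing Implicit Defensive.

Import GRing.Theory.

Local Open Scope ring_scope.
Local Open Scope quotient_scope.
Local Open Scope classical_set_scope.
Local Open Scope card_scope.

(** * Cardinal arithmetic *)

(** [G] may relate an element to several values: choice selects one of them, and the second clause
    makes every selection injective. A relation spares the default values that a function on the
    whole of [T] requires. *)
Lemma card_le_relP (T U : Type) (A : set T) (B : set U) :
  A #<= B <-> exists G : T -> U -> Prop,
    (forall x, A x -> exists2 y, B y & G x y) /\
    (forall x x' y, A x -> A x' -> G x y -> G x' y -> x = x').
Proof.
split=> [/card_leP[f]|[G [Gtot Ginj]]].
  exists (fun x y => exists xA : x \in A, val (f (SigSub xA)) = y); split.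
    move=> x /mem_set xA; exists (val (f (SigSub xA))); last by exists xA.
    exact: set_valP.
  move=> x x' y _ _ [xA <-] [x'A] /val_inj e.
  by have := inj (in_setT (SigSub xA)) (in_setT _) (esym e) => -[].
have F (x : A) : {y : B | G (val x) (val y)}.
  apply: cid; have [y By Gy] := Gtot _ (set_valP x).
  by exists (SigSub (mem_set By)).
apply/card_leP/injfunPex; exists (fun x => sval (F x)) => // x x' _ _ e.
apply: val_inj; apply: (Ginj _ _ (val (sval (F x)))); [exact: set_valP..| |].
  exact: (svalP (F x)).
by rewrite e; exact: (svalP (F x')).
Qed.

Lemma card_le_inj (T U : Type) (A : set T) (B : set U) (f : T -> U) :
  (forall x, A x -> B (f x)) ->
  (forall x x', A x -> A x' -> f x = f x' -> x = x') -> A #<= B.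
Proof.
move=> fB fI; apply/card_le_relP; exists (fun x y => f x = y); split.
  by move=> x Ax; exists (f x) => //; exact: fB.
by move=> x x' y Ax Ax' <- e; exact: fI.
Qed.

(** By Zorn's lemma there is a maximal partial injection from [A] to [B]. It is defined on all of
    [A] or reaches all of [B], since otherwise one more pair could be added. *)
Lemma card_le_total (T U : Type) (A : set T) (B : set U) :
  A #<= B \/ B #<= A.
Proof.
pose P (G : set (T * U)) := [/\ G `<=` A `*` B,
  forall x x' y, G (x, y) -> G (x', y) -> x = x' &
  forall x y y', G (x, y) -> G (x, y') -> y = y'].
have [|G [[GAB Gi Gf] Gmax]] := @Zorn_bigcup _ P.
  move=> F FP Ftot; split.
  - by move=> p [G FG Gp]; have [+ _ _] := FP _ FG; exact.
  - move=> x x' y [G FG Gp] [H FH Hp].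
    have [GH|HG] := Ftot _ _ FG FH.
      by have [_ + _] := FP _ FH; apply; [exact: GH Gp|].
    by have [_ + _] := FP _ FG; apply; [|exact: HG Hp].
  - move=> x y y' [G FG Gp] [H FH Hp].
    have [GH|HG] := Ftot _ _ FG FH.
      by have [_ _ +] := FP _ FH; apply; [exact: GH Gp|].
    by have [_ _ +] := FP _ FG; apply; [|exact: HG Hp].
have [Gtot|/existsNP[a /not_implyP[Aa aG]]] :=
    pselect (forall x, A x -> exists y, G (x, y)).
  left; apply/card_le_relP; exists (fun x y => G (x, y)); split.
    by move=> x /Gtot[y Gxy]; exists y => //; exact: (GAB _ Gxy).2.
  by move=> x x' y _ _; exact: Gi.
have [Gsurj|/existsNP[b /not_implyP[Bb bG]]] :=
    pselect (forall y, B y -> exists x, G (x, y)).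
  right; apply/card_le_relP; exists (fun y x => G (x, y)); split.
    by move=> y /Gsurj[x Gxy]; exists x => //; exact: (GAB _ Gxy).1.
  by move=> y y' x _ _; exact: Gf.
exfalso; apply: (Gmax (G `|` [set (a, b)])).
  split; first by move=> p; left.
  by move=> /(_ (a, b) (or_intror erefl)) Gab; apply: aG; exists b.
split.
- by move=> p [/GAB//|->].
- move=> x x' y [Gxy|[-> eb]] [Gxy'|[-> eb']]//.
  + exact: Gi Gxy Gxy'.
  + by case: bG; exists x; rewrite -eb'.
  + by case: bG; exists x'; rewrite -eb.
- move=> x y y' [Gxy|[ea ->]] [Gxy'|[ea' ->]]//.
  + exact: Gf Gxy Gxy'.
  + by case: aG; exists y; rewrite -ea'.
  + by case: aG; exists y'; rewrite -ea.
Qed.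

Lemma card_le_setX (T T' U U' : Type) (A : set T) (B : set U)
    (A' : set T') (B' : set U') :
  A #<= B -> A' #<= B' -> A `*` A' #<= B `*` B'.
Proof.
move=> /card_le_relP[G [Gt Gi]] /card_le_relP[H [Ht Hi]]; apply/card_le_relP.
exists (fun p q => G p.1 q.1 /\ H p.2 q.2); split.
  move=> [x x'] [/= /Gt[y By Gy] /Ht[y' By' Hy']].
  by exists (y, y').
move=> [x1 x2] [y1 y2] [z1 z2] [/= ? ?] [/= ? ?] [/= G1 H1] [/= G2 H2].
by rewrite (Gi _ _ _ _ _ G1 G2)// (Hi _ _ _ _ _ H1 H2).
Qed.

(** The square of [C] contains two disjoint copies of [C], tagged by [c0] and [c1]; elements of [A]
    go to the first and the others to the second. *)
Lemma card_le_setU (T U : Type) (A B : set T) (C : set U) (c0 c1 : U) :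
  C c0 -> C c1 -> c0 <> c1 -> C `*` C #<= C ->
  A #<= C -> B #<= C -> A `|` B #<= C.
Proof.
move=> Cc0 Cc1 c01 CC /card_le_relP[G [Gt Gi]] /card_le_relP[H [Ht Hi]].
apply: card_le_trans CC; apply/card_le_relP.
exists (fun x q => A x /\ q.1 = c0 /\ G x q.2 \/
                   ~ A x /\ B x /\ q.1 = c1 /\ H x q.2); split.
  move=> x ABx; have [Ax|nAx] := pselect (A x).
    by have [y Cy Gy] := Gt _ Ax; exists (c0, y) => //; left.
  case: ABx => // Bx; have [y Cy Hy] := Ht _ Bx.
  by exists (c1, y) => //; right.
move=> x x' [y1 y2] _ _ [[Ax [/= -> Gx]]|[nAx [Bx [/= -> Hx]]]].
  by move=> [[Ax' [_ Gx']]|[_ [_ [/c01]]]]//; exact: Gi Gx Gx'.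
move=> [[_ [/esym/c01]]//|[_ [Bx' [_ Hx']]]]; exact: Hi Hx Hx'.
Qed.

Lemma card_le_sub (T U : Type) (A : set T) (B : set U) :
  A #<= B -> exists2 C, C `<=` B & A #= C.
Proof.
move=> /card_le_relP[G [Gt Gi]].
have [->|/set0P[a0 Aa0]] := eqVneq A set0.
  by exists set0 => //; exact: card_eq00.
have [u _ _] := Gt _ Aa0.
(* The point [u] is the default value of [f] outside [A]. *)
have /boolp.choice[f fP] : forall x, exists y, A x -> B y /\ G x y.
  move=> x; have [Ax|nAx] := pselect (A x); last by exists u.
  by have [y By Gy] := Gt _ Ax; exists y.
exists (f @` A); first by move=> _ [x /fP[? _] <-].
rewrite card_eq_sym; apply: inj_card_eq => x y /set_mem Ax /set_mem Ay e.
apply: (Gi _ _ (f x)) => //; first exact: (fP _ Ax).2.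
by rewrite e; exact: (fP _ Ay).2.
Qed.

Lemma infinite_two (T : Type) (A : set T) : infinite_set A ->
  exists a b, [/\ A a, A b & a <> b].
Proof.
move=> Ainf; have [a Aa] := infinite_setN0 Ainf.
have [b [Ab nb]] : (A `\` [set a]) !=set0.
  by apply/infinite_setN0/infinite_setD => //; exact: finite_set1.
by exists a, b; split => // e; apply: nb.
Qed.

Lemma infinite_setX_le (T : Type) (A : set T) :
  infinite_set A -> A `*` A #<= A.
Proof.
move=> Ainf.
(* Zorn on relations G that are total and injective from (X G)^2 to X G, with
   X G a subset of A; functionality of G is not needed to bound (X G)^2. *)
pose X (G : set (T * T * T)) := [set x | exists y z, G (x, y, z)].
pose P (G : set (T * T * T)) := [/\
  forall x y z, G (x, y, z) -> [/\ X G x, X G y & X G z], X G `<=` A,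
  forall x y, X G x -> X G y -> exists z, G (x, y, z) &
  forall p q z, G (p, z) -> G (q, z) -> p = q].
have XS G H : G `<=` H -> X G `<=` X H.
  by move=> GH x [y [z /GH Hx]]; exists y, z.
have [|G [[Gfld GA Gt Gi] Gmax]] := @Zorn_bigcup _ P.
  move=> F FP Ftot; split.
  - move=> x y z [G FG Gp]; have [+ _ _ _] := FP _ FG.
    have /XS GF : G `<=` \bigcup_(H in F) H by move=> p Gp'; exists G.
    by move=> /(_ _ _ _ Gp)[? ? ?]; split; exact: GF.
  - by move=> x [y [z [G FG Gp]]]; have [_ + _ _] := FP _ FG; apply; exists y, z.
  - move=> x y [x1 [x2 [G FG Gp]]] [y1 [y2 [H FH Hp]]].
    have [GH|HG] := Ftot _ _ FG FH.
      have [_ _ + _] := FP _ FH => /(_ x y)[||z Hz]; last by exists z, H.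
        by exists x1, x2; exact: GH.
      by exists y1, y2.
    have [_ _ + _] := FP _ FG => /(_ x y)[||z Gz]; last by exists z, G.
      by exists x1, x2.
    by exists y1, y2; exact: HG.
  - move=> p q z [G FG Gp] [H FH Hp].
    have [GH|HG] := Ftot _ _ FG FH.
      by have [_ _ _ +] := FP _ FH; apply; [exact: GH Gp|].
    by have [_ _ _ +] := FP _ FG; apply; [|exact: HG Hp].
have XX : X G `*` X G #<= X G.
  apply/card_le_relP; exists (fun p z => G (p, z)); split.
    move=> [x y] [/= Xx Xy]; have [z Gz] := Gt _ _ Xx Xy.
    by exists z => //; have [_ _ ?] := Gfld _ _ _ Gz.
  by move=> p q z _ _; exact: Gi.
(* If such a [Y] absorbed the square of [X G] united with [Y], then [G] could be extended: pairs not
   both in [X G] receive values in [Y], which avoid the values of [G]. This contradicts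
   maximality. *)
have ext (Y : set T) : Y `<=` A `\` X G -> infinite_set Y ->
    ~ ((X G `|` Y) `*` (X G `|` Y) #<= Y).
  move=> YA Yinf /card_le_relP[H [Ht Hi]].
  pose W := X G `|` Y.
  pose K : set (T * T * T) := [set t | [/\ W t.1.1, W t.1.2,
     ~ (X G t.1.1 /\ X G t.1.2), Y t.2 & H t.1 t.2]].
  have XK : X (G `|` K) = W.
    apply/seteqP; split=> [x [y [z [Gx|[]//]]]|x Wx].
      by left; exists y, z.
    have [Xx|nXx] := pselect (X G x).
      by have [z Gz] := Gt _ _ Xx Xx; exists x, z; left.
    have [z Yz Hz] := Ht (x, x) (conj Wx Wx).
    by exists x, z; right; split => // -[].
  have [y0 Yy0] := infinite_setN0 Yinf.
  apply: (Gmax (G `|` K)).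
    split; first by move=> p; left.
    move=> /XS; rewrite XK => /(_ y0 (or_intror Yy0)).
    exact: (YA _ Yy0).2.
  rewrite /P XK; split.
  - move=> x y z [/Gfld[? ? ?]|[/= ? ? _ ? _]]; first by split; left.
    by split => //; right.
  - by move=> x [/GA|/YA[]].
  - move=> x y Wx Wy; have [[Xx Xy]|nXxy] := pselect (X G x /\ X G y).
      by have [z Gz] := Gt _ _ Xx Xy; exists z; left.
    have [z Yz Hz] := Ht (x, y) (conj Wx Wy).
    by exists z; right; split.
  - have GK (p : T * T) z q : G (p, z) -> ~ K (q, z).
      case: p => x y /Gfld[_ _ Xz] [/= _ _ _ /YA[_]]; exact.
    move=> p q z [Gp|Kp] [Gq|Kq].
    + exact: Gi Gp Gq.
    + by case: (GK _ _ _ Gp Kq).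
    + by case: (GK _ _ _ Gq Kp).
    + case: Kp Kq => /= ? ? _ _ Hp [/= ? ? _ _ Hq].
      by apply: Hi Hp Hq.
(* When [X G] is finite, its complement in [A] contains a countably infinite [Y], and the union and
   its square stay countable. *)
have [Xfin|Xinf] := pselect (finite_set (X G)).
  have /infiniteP/card_le_sub[Y YA NY] := infinite_setD Ainf Xfin.
  have Yinf : infinite_set Y.
    by apply/infiniteP; move: NY; rewrite card_eq_le => /andP[].
  have Yc : countable Y by rewrite -(eq_countable NY).
  exfalso; apply: (ext Y) => //.
  apply: (@card_le_trans _ _ _ [set: nat]); last exact/infiniteP.
  have WC : countable (X G `|` Y).
    apply: (@card_le_setU _ _ _ _ [set: nat] 0%N 1%N) => //.
      exact: countableP.
    exact: finite_set_countable.
  exact: countableX.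
have [a [b [Xa Xb ab]]] := infinite_two Xinf.
(* Either the rest of [A] is no larger than [X G], so that [A] is bounded by [X G], or it contains a
   copy [Y] of [X G], to which [ext] applies. *)
have [AX|/card_le_sub[Y YA XY]] := card_le_total (A `\` X G) (X G).
  have AXle : A #<= X G.
    rewrite -(setDUK GA); apply: (card_le_setU Xa Xb) => //.
  apply: card_le_trans (card_le_setX AXle AXle) _.
  exact: card_le_trans XX (subset_card_le GA).
have /andP[XleY YleX] : (X G #<= Y) && (Y #<= X G) by rewrite -card_eq_le.
have Yinf : infinite_set Y by rewrite -(eq_finite_set XY).
exfalso; apply: (ext Y) => //.
have W : X G `|` Y #<= X G by apply: (card_le_setU Xa Xb).
apply: card_le_trans (card_le_setX W W) _.
exact: card_le_trans XX XleY.
Qed.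

Lemma infinite_card_setU (T U : Type) (A B : set T) (C : set U) :
  infinite_set C -> A #<= C -> B #<= C -> A `|` B #<= C.
Proof.
move=> Cinf; have [a [b [Ca Cb ab]]] := infinite_two Cinf.
exact: card_le_setU Ca Cb ab (infinite_setX_le Cinf).
Qed.

(** The larger of [A] and [B] is infinite and bounds the union. It cannot be [B], hence it is
    [A]. *)
Lemma card_le_setU_absorb (T U : Type) (V : set U) (A B : set T) :
  infinite_set V -> V #<= A `|` B -> ~ (V #<= B) -> V #<= A.
Proof.
move=> Vinf VAB VB.
have ABinf : infinite_set (A `|` B) by move/(card_le_finite VAB).
have [AB|BA] := card_le_total A B.
  have Binf : infinite_set B.
    move=> Bf; apply: ABinf; rewrite finite_setU; split => //.
    exact: card_le_finite AB Bf.
  by case: VB; apply: card_le_trans VAB _; exact: infinite_card_setU.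
have Ainf : infinite_set A.
  move=> Af; apply: ABinf; rewrite finite_setU; split => //.
  exact: card_le_finite BA Af.
by apply: card_le_trans VAB _; exact: infinite_card_setU.
Qed.

Lemma card_ltNge (T U : Type) (A : set T) (B : set U) :
  ~ (B #<= A) -> card_lt A B.
Proof. by move=> BA; split => //; case: (card_le_total A B). Qed.

(** * Submodules *)

Section PropSubmod.
Variables (R : pzRingType) (M : lmodType R) (P : M -> Prop).
Hypotheses (P0 : P 0) (Plin : forall a u v, P u -> P v -> P (a *: u + v)).

(** Submodules are Boolean predicates, so a [Prop]-valued condition is first made Boolean
    classically. *)
Definition prop_submod_pred : {pred M} := fun x => `[< P x >].

Fact prop_submod_closed : GRing.submod_closed prop_submod_pred.
Proof.
by split=> [|a u v /asboolP Pu /asboolP Pv]; apply/asboolP => //; exact: Plin.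
Qed.

Definition prop_submod : submodClosed M :=
  HB.pack_for (submodClosed M) prop_submod_pred
    (GRing.isSubmodClosed.Build R M prop_submod_pred prop_submod_closed).

Lemma prop_submodP x : reflect (P x) (x \in prop_submod).
Proof. exact: asboolP. Qed.

End PropSubmod.

Section Submodules.
Variables (R : pzRingType) (M : lmodType R).
Implicit Types N K L : submodClosed M.

Lemma submodP N a u v : u \in N -> v \in N -> a *: u + v \in N.
Proof. by move=> Nu Nv; rewrite rpredD ?rpredZ. Qed.

Lemma submodB N u v : u \in N -> v \in N -> u - v \in N.
Proof. by move=> Nu Nv; rewrite addrC -scaleN1r submodP. Qed.

Lemma subset_submod_anti N K : {subset N <= K} -> {subset K <= N} -> N = K.
Proof.
by move=> NK KN; apply: submod_ext => x; apply/idP/idP; [exact: NK|exact: KN].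
Qed.

Lemma submodN N u : u \in N -> - u \in N.
Proof. by move=> Nu; rewrite -sub0r submodB ?rpred0. Qed.

Lemma is_zeroP N : is_zero N <-> forall x, x \in N -> x = 0.
Proof.
split=> [N0 x|N0 x]; first by rewrite N0 => /eqP.
by apply/idP/eqP => [/N0//|->]; exact: rpred0.
Qed.

Lemma is_zeroIP N K :
  is_zero [predI N & K] <-> forall x, x \in N -> x \in K -> x = 0.
Proof.
split=> [NK0 x Nx Kx|NK0 x].
  by apply/eqP; have := NK0 x; rewrite !inE Nx Kx => <-.
rewrite !inE; apply/andP/eqP => [[]|->]; first exact: NK0.
by split; exact: rpred0.
Qed.

Lemma not_is_zeroP N : ~ is_zero N <-> exists2 x, x \in N & x != 0.
Proof.
split=> [/is_zeroP/existsNP[x /not_implyP[Nx /eqP x0]]|]; first by exists x.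
by move=> [x Nx x0] /is_zeroP/(_ _ Nx) e; rewrite e eqxx in x0.
Qed.

Lemma is_fullP N : is_full N <-> forall x, x \in N.
Proof. by split=> [Nf x|Nf x]; [rewrite Nf|rewrite Nf]. Qed.

Fact addsub0 N K : exists u v, [/\ u \in N, v \in K & 0 = u + v].
Proof. by exists 0, 0; rewrite !rpred0 addr0. Qed.

Fact addsub_lin N K a x y :
  (exists u v, [/\ u \in N, v \in K & x = u + v]) ->
  (exists u v, [/\ u \in N, v \in K & y = u + v]) ->
  exists u v, [/\ u \in N, v \in K & a *: x + y = u + v].
Proof.
move=> [u [v [Nu Kv ->]]] [u' [v' [Nu' Kv' ->]]].
exists (a *: u + u'), (a *: v + v'); split; try exact: submodP.
by rewrite scalerDr addrACA.
Qed.

Definition add_submod N K : submodClosed M :=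
  prop_submod (addsub0 N K) (@addsub_lin N K).

Lemma add_submodP N K x :
  reflect (exists u v, [/\ u \in N, v \in K & x = u + v])
          (x \in add_submod N K).
Proof. exact: prop_submodP. Qed.

(** This form matches the graph relation [s + t \in K] through which complements are later read as
    maps. *)
Lemma add_submod_shiftP N K x :
  x \in add_submod N K <-> exists2 s, s \in N & s + x \in K.
Proof.
split=> [/add_submodP[u [v [Nu Kv ->]]]|[s Ns Kx]].
  by exists (- u); rewrite ?submodN// addKr.
by apply/add_submodP; exists (- s), (s + x); rewrite submodN// addKr.
Qed.

Lemma sub_add_submodl N K : {subset N <= add_submod N K}.
Proof. by move=> x Nx; apply/add_submodP; exists x, 0; rewrite rpred0 addr0. Qed.

Lemma sub_add_submodr N K : {subset K <= add_submod N K}.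
Proof. by move=> x Kx; apply/add_submodP; exists 0, x; rewrite rpred0 add0r. Qed.

Fact cap_submod_closed N K :
  (0 \in N /\ 0 \in K) /\ forall a u v,
  (u \in N /\ u \in K) -> (v \in N /\ v \in K) ->
  a *: u + v \in N /\ a *: u + v \in K.
Proof. by rewrite !rpred0; split=> // a u v [? ?] [? ?]; rewrite !submodP. Qed.

Definition cap_submod N K : submodClosed M :=
  prop_submod (cap_submod_closed N K).1 (cap_submod_closed N K).2.

Lemma cap_submodP N K x :
  reflect (x \in N /\ x \in K) (x \in cap_submod N K).
Proof. exact: prop_submodP. Qed.

End Submodules.

(** * Preimages and images of submodules under a linear map *)

Section Images.
Variables (R : pzRingType) (U V : lmodType R) (f : {linear U -> V}).

Fact preim_submod_closed (N : submodClosed V) :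
  f 0 \in N /\ forall a u v, f u \in N -> f v \in N -> f (a *: u + v) \in N.
Proof.
by rewrite linear0 rpred0; split=> // a u v ? ?; rewrite linearP submodP.
Qed.

Definition preim_submod (N : submodClosed V) : submodClosed U :=
  prop_submod (preim_submod_closed N).1 (preim_submod_closed N).2.

Lemma preim_submodP (N : submodClosed V) x : (x \in preim_submod N) = (f x \in N).
Proof. exact/prop_submodP/idP. Qed.

Fact im_submod_closed (N : submodClosed U) :
  (exists2 x, x \in N & f x = 0) /\ forall a u v,
  (exists2 x, x \in N & f x = u) -> (exists2 x, x \in N & f x = v) ->
  exists2 x, x \in N & f x = a *: u + v.
Proof.
split=> [|a _ _ [x Nx <-] [y Ny <-]]; first by exists 0; rewrite ?rpred0 ?linear0.
by exists (a *: x + y); rewrite ?submodP ?linearP.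
Qed.

Definition im_submod (N : submodClosed U) : submodClosed V :=
  prop_submod (im_submod_closed N).1 (im_submod_closed N).2.

Lemma im_submodP (N : submodClosed U) y :
  reflect (exists2 x, x \in N & f x = y) (y \in im_submod N).
Proof. exact: prop_submodP. Qed.

Lemma simple_module_iso :
  bijective f -> simple_module U -> simple_module V.
Proof.
move=> [g fK gK] [[u u0] simU]; split.
  exists (f u); apply: contra u0 => /eqP fu.
  by rewrite -(fK u) fu -(linear0 f) fK.
move=> N; have [/is_zeroP N0|/is_fullP Nf] := simU (preim_submod N).
  left; apply/is_zeroP => y Ny.
  by rewrite -(gK y) [g y]N0 ?linear0// preim_submodP gK.
by right; apply/is_fullP => y; rewrite -(gK y) -preim_submodP.
Qed.

End Images.

(** Choice provides the values; as [G] is functional and compatible with linear combinations, the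
    value chosen at a combination is forced. *)
Lemma linear_of_graph (R : pzRingType) (U V : lmodType R) (G : U -> V -> Prop) :
  (forall u, exists v, G u v) ->
  (forall u v v', G u v -> G u v' -> v = v') ->
  (forall a u v u' v', G u v -> G u' v' -> G (a *: u + u') (a *: v + v')) ->
  exists f : {linear U -> V}, forall u, G u (f u).
Proof.
move=> /boolp.choice[f Gf] Gfun Glin.
have lf : linear f by move=> a u v; apply: Gfun (Gf _) _; exact: Glin.
pose F := HB.pack_for {linear U -> V} f (GRing.isLinear.Build R U V _ f lf).
by exists F.
Qed.

(** * Simplicity of a submodule viewed as a module *)

Section SubmodType.
Variables (R : pzRingType) (M : lmodType R) (S : submodClosed M).
Implicit Types N : submodClosed M.

(** Preimage and image under the inclusion [val] carry submodules of [M] lying in [S] to submodules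
    of the module [S], and back. *)
Lemma simple_submodP : simple_module (submod_type S) <->
  ~ is_zero S /\ forall N, {subset N <= S} -> is_zero N \/ N = S.
Proof.
split=> [[[u u0] simS]|[S0 simS]]; split.
- apply/not_is_zeroP; exists (val u); first exact: valP.
  by apply: contra u0 => /eqP u0; apply/eqP/val_inj; rewrite u0 linear0.
- move=> N NS; have [/is_zeroP N0|/is_fullP Nf] := simS (preim_submod val N).
    left; apply/is_zeroP => x Nx.
    have := N0 (SubmodElt (NS _ Nx)); rewrite preim_submodP => /(_ Nx)/(congr1 val) e.
    by rewrite -[x]/(val (SubmodElt (NS _ Nx))) e linear0.
  right; apply: subset_submod_anti => // x Sx.
  by have := Nf (SubmodElt Sx); rewrite preim_submodP.
- have /not_is_zeroP[x Sx x0] := S0; exists (SubmodElt Sx).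
  apply: contra x0 => /eqP/(congr1 val) e.
  by rewrite -[x]/(val (SubmodElt Sx)) e linear0.
- move=> N; have [|/is_zeroP N0|Nf] := simS (im_submod val N).
  + by move=> _ /im_submodP[x _ <-]; exact: valP.
  + left; apply/is_zeroP => u Nu; apply: val_inj; rewrite linear0; apply: N0.
    by apply/im_submodP; exists u.
  + right; apply/is_fullP => u; have : val u \in im_submod val N.
      by rewrite Nf; exact: valP.
    by move=> /im_submodP[v Nv /val_inj <-].
Qed.

End SubmodType.

(** * The projection onto a quotient module *)

Section Quotient.
Variables (R : pzRingType) (M : lmodType R) (S : submodClosed M).

Definition quot_pi (x : M) : quotmod S := \pi_(quotmod S) x.

Fact quot_pi_linear : linear quot_pi.
Proof. by move=> a u v; rewrite /quot_pi quotmod_piD quotmod_piZ. Qed.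

HB.instance Definition _ :=
  GRing.isLinear.Build R M (quotmod S) _ quot_pi quot_pi_linear.

Lemma quot_piE x y : quot_pi x = quot_pi y <-> x - y \in S.
Proof. exact: quotmod_piE. Qed.

Lemma quot_pi_eq0 x : quot_pi x = 0 <-> x \in S.
Proof. by rewrite -(linear0 quot_pi) quot_piE subr0. Qed.

Lemma quot_pi_surj q : exists x, quot_pi x = q.
Proof. by exists (repr q); exact: reprK. Qed.

End Quotient.

(** * Complements of a maximal submodule *)

Section Complements.
Variables (R : pzRingType) (M : lmodType R) (T : submodClosed M).
Implicit Types K L S : submodClosed M.

Definition complements : set (submodClosed M) := [set K | direct_sum K T].

Lemma complement_capT K x : complements K -> x \in K -> x \in T -> x = 0.
Proof. by case=> /is_zeroIP + _; exact. Qed.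

(** Write an element of [K] as [u + v] along [S] and [T]: then [v] lies both in [K] and in [T],
    hence vanishes. *)
Lemma complement_sub_eq S K :
  complements S -> complements K -> {subset S <= K} -> S = K.
Proof.
move=> [_ ST] CK SK; apply: subset_submod_anti => // x Kx.
have [u [v [Su Tv xE]]] := ST x.
have v0 : v = 0.
  apply: (complement_capT CK) => //.
  have -> : v = x - u by rewrite xE addrC addKr.
  by apply: submodB => //; exact: SK.
by rewrite xE v0 addr0.
Qed.

(** With [complement_uniq], this presents [K] as the graph of a map with values in [T]: the value at
    [s] is the only [t] in [T] with [s + t] in [K]. *)
Lemma complement_shift K s :
  complements K -> exists2 t, t \in T & s + t \in K.
Proof.
move=> [_ /(_ s)[k [t [Kk Tt ->]]]].
by exists (- t); rewrite ?submodN// addrK.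
Qed.

Lemma complement_uniq K s t t' : complements K -> t \in T -> t' \in T ->
  s + t \in K -> s + t' \in K -> t = t'.
Proof.
move=> CK Tt Tt' Kt Kt'; apply/eqP; rewrite -subr_eq0; apply/eqP.
apply: (complement_capT CK); last exact: submodB.
have -> : t - t' = s + t - (s + t') by rewrite opprD addrACA subrr add0r.
exact: submodB.
Qed.

(** As a map from [S] to [T] with graph [K], the complement [K] has image [S'], the intersection of
    [T] with [S + K], and kernel the intersection of [S] and [K]. By simplicity the kernel is zero,
    or it is [S], which forces [S = K]. *)
Lemma complement_iso S K : simple_module (submod_type S) ->
  complements S -> complements K -> S <> K ->
  exists2 S' : submodClosed M, {subset S' <= T} &
    module_iso (submod_type S) (submod_type S').
Proof.
move=> /simple_submodP[_ simS] CS CK SK.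
pose S' := cap_submod T (add_submod S K).
have S'P t : t \in S' <-> t \in T /\ exists2 s, s \in S & s + t \in K.
  by split=> [/cap_submodP[Tt /add_submod_shiftP]//|[Tt /add_submod_shiftP ?]];
    exact/cap_submodP.
exists S'; first by move=> t /S'P[].
have valT (v : submod_type S') : val v \in T by case/S'P: (valP v).
have [|||f fP] := @linear_of_graph _ (submod_type S) (submod_type S')
    (fun u v => val u + val v \in K).
- move=> u; have [t Tt Kt] := complement_shift (val u) CK.
  have S't : t \in S'.
    by apply/S'P; split => //; exists (val u) => //; exact: valP.
  by exists (SubmodElt S't).
- move=> u v v' Kv Kv'; apply: val_inj.
  by apply: complement_uniq CK _ _ Kv Kv'; exact: valT.
- move=> a u v u' v' Kv Kv'.
  by rewrite !linearP /= addrACA -scalerDr submodP.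
exists f.
have [x /cap_submodP[]//|SK0|capS] := simS (cap_submod S K).
- have finj : injective f.
    move=> u v fuv; apply: val_inj; apply/eqP; rewrite -subr_eq0; apply/eqP.
    move/is_zeroP: SK0; apply; apply/cap_submodP; split.
      by apply: submodB; exact: valP.
    have -> : val u - val v = val u + val (f u) - (val v + val (f v)).
      by rewrite fuv opprD addrACA subrr addr0.
    exact: submodB.
  have /boolp.choice[g fg] : forall v, exists u, f u = v.
    move=> v; have [_ [s Ss Ks]] := (S'P (val v)).1 (valP v).
    exists (SubmodElt Ss); apply: val_inj.
    exact: (@complement_uniq K s _ _ CK (valT _) (valT v) (fP (SubmodElt Ss)) Ks).
  by exists g => // u; apply: finj; rewrite fg.
- case: SK; apply: complement_sub_eq => // x.
  by rewrite -capS => /cap_submodP[].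
Qed.

(** The map from [S] to [T] with graph [K] takes its values in [S']; followed by the isomorphism
    from [S'] to [S], it becomes an endomorphism of [S]. *)
Lemma complements_le_End S S' : complements S ->
  simple_module (submod_type S) -> essential_in S' T ->
  module_iso (submod_type S) (submod_type S') ->
  complements #<= End_set (submod_type S).
Proof.
move=> CS /simple_submodP[S0 simS] [S'T S'ess] [f [h fK hK]].
apply/card_le_relP.
exists (fun K (g : {linear submod_type S -> submod_type S}) =>
  forall s, val s + val (f (g s)) \in K); split; last first.
  (* Injectivity: [g] determines [K], because the [T]-part of an element of [K] is determined by its
     [S]-part. *)
  suff sub K K' (g : {linear submod_type S -> submod_type S}) :
      complements K -> complements K' ->
      (forall s, val s + val (f (g s)) \in K) ->
      (forall s, val s + val (f (g s)) \in K') -> {subset K <= K'}.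
    move=> K K' g CK CK' gK gK'.
    by apply: subset_submod_anti; [exact: (sub K K' g)|exact: (sub K' K g)].
  move=> CK CK' gK gK' x Kx; have [_ /(_ x)[u [v [Su Tv xE]]]] := CS.
  have <- : u + val (f (g (SubmodElt Su))) = x.
    rewrite xE; congr (_ + _).
    apply: complement_uniq CK _ Tv (gK (SubmodElt Su)) _; last by rewrite -xE.
    by apply: S'T; exact: valP.
  exact: gK' (SubmodElt Su).
move=> K CK.
(* The elements of [S] whose value lies in [S'] form a submodule of [S], hence zero or all of
   [S]. *)
have [s /cap_submodP[]//|/is_zeroP J0|JS] :=
  simS (cap_submod S (add_submod S' K)).
  have {}J0 s t : s \in S -> t \in S' -> s + t \in K -> s = 0.
    move=> Ss S't Kst; apply: J0; apply/cap_submodP; split => //.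
    by apply/add_submod_shiftP; exists t; rewrite // addrC.
  (* In the zero case the image of [S] in [T] meets [S'] trivially, so it must be nonzero to
     contradict essentiality. Were it zero, every value would be [0], which lies in [S'], and [J0]
     would make [S] zero. *)
  exfalso; apply: (S'ess (cap_submod T (add_submod S K))).
  - by move=> t /cap_submodP[].
  - move=> /is_zeroP I0; move/not_is_zeroP: S0 => [s Ss /eqP]; apply.
    have [t Tt Kt] := complement_shift s CK.
    have t0 : t = 0.
      apply: I0; apply/cap_submodP; split => //.
      by apply/add_submod_shiftP; exists s.
    by apply: (J0 s 0) => //; rewrite ?rpred0// -t0.
  - apply/is_zeroIP => t S't /cap_submodP[Tt /add_submod_shiftP[s Ss Ks]].
    move: (Ks); rewrite (J0 s t)// add0r => Kt.
    exact: complement_capT CK Kt Tt.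
have [|||g gP] := @linear_of_graph _ (submod_type S) (submod_type S)
    (fun s s' => val s + val (f s') \in K).
- move=> s; have : val s \in cap_submod S (add_submod S' K).
    by rewrite JS; exact: valP.
  move=> /cap_submodP[_ /add_submod_shiftP[t S't Kt]].
  by exists (h (SubmodElt S't)); rewrite hK addrC.
- move=> s u u' Ku Ku'; apply: (can_inj fK); apply: val_inj.
  by apply: complement_uniq CK _ _ Ku Ku'; apply: S'T; exact: valP.
- move=> a u v u' v' Kv Kv'.
  by rewrite !linearP /= addrACA -scalerDr submodP.
by exists g.
Qed.

(** An endomorphism [g] is sent to the graph of [f] after [g], viewed inside the direct sum [M]. A
    graph determines its map, is nonzero as [S] is, and contains no nonzero element of [T]. *)
Lemma End_le_vertices S S' : complements S -> ~ is_zero S -> ~ is_zero T ->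
  {subset S' <= T} -> module_iso (submod_type S) (submod_type S') ->
  End_set (submod_type S) #<= ig_vertices M.
Proof.
move=> CS S0 T0 S'T [f [h fK hK]].
pose P (g : {linear submod_type S -> submod_type S}) x :=
  exists s, x = val s + val (f (g s)).
have P0 g : P g 0 by exists 0; rewrite !linear0 addr0.
have PS g a u v : P g u -> P g v -> P g (a *: u + v).
  move=> [s ->] [s' ->]; exists (a *: s + s').
  by rewrite !linearP /= scalerDr addrACA.
have fT g s : val (f (g s)) \in T by apply: S'T; exact: valP.
have eq0 (u v : M) : u \in S -> v \in T -> u + v = 0 -> u = 0.
  move=> Su Tv e; apply: (complement_capT CS) => //.
  have -> : u = - v by apply/eqP; rewrite -addr_eq0 e.
  exact: submodN.
apply: (@card_le_inj _ _ _ _ (fun g => prop_submod (P0 g) (PS g))).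
  move=> g _; split.
    move/not_is_zeroP: S0 => [s Ss /eqP s0] /is_zeroP Z; apply: s0.
    apply: (eq0 _ (val (f (g (SubmodElt Ss))))) => //.
    by apply: Z; apply/prop_submodP; exists (SubmodElt Ss).
  move=> /is_fullP F; move/not_is_zeroP: T0 => [t Tt /eqP]; apply.
  have /prop_submodP[s tE] := F t.
  have s0 : s = 0.
    apply: val_inj; rewrite linear0; apply: (eq0 _ (val (f (g s)) - t)).
    - exact: valP.
    - exact: submodB.
    - by rewrite addrA -tE subrr.
  by rewrite tE s0 !linear0 addr0.
move=> g g' _ _ e; apply: linear_ext => s; apply: (can_inj fK); apply: val_inj.
have : val s + val (f (g s)) \in prop_submod (P0 g) (PS g).
  by apply/prop_submodP; exists s.
rewrite e => /prop_submodP[s' sE].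
have ss' : s = s'.
  apply: val_inj; apply/eqP; rewrite -subr_eq0; apply/eqP.
  apply: (eq0 _ (val (f (g s)) - val (f (g' s')))).
  - by apply: submodB; exact: valP.
  - exact: submodB.
  - by rewrite addrACA -opprD sE subrr.
by move: sE; rewrite -ss' => /addrI.
Qed.

Hypothesis maxT : maximal_submod T.

(** The submodule [K + T] contains [T], and strictly so since [K] is nonzero and meets [T]
    trivially; by maximality it is [M]. *)
Lemma maximal_complement K :
  ~ is_zero K -> is_zero [predI K & T] -> complements K.
Proof.
move=> K0 KT; split => //.
have [e|/is_fullP F] := maxT.2 _ (@sub_add_submodr _ _ K T).
  case: K0; apply/is_zeroP => x Kx; move/is_zeroIP: KT; apply => //.
  by rewrite -e; exact: sub_add_submodl.
by move=> x; exact/add_submodP.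
Qed.

(** A nonzero submodule of [K] is again a complement of [T], and nested complements coincide. *)
Lemma maximal_complement_simple K :
  complements K -> simple_module (submod_type K).
Proof.
move=> CK; apply/simple_submodP; split.
  move=> /is_zeroP K0; apply: maxT.1; apply/is_fullP => x.
  by have [_ /(_ x)[u [v [/K0 -> Tv ->]]]] := CK; rewrite add0r.
move=> L LK; have [?|L0] := pselect (is_zero L); [by left|right].
apply: complement_sub_eq => //; apply: maximal_complement => //.
by apply/is_zeroIP => x /LK; exact: complement_capT.
Qed.

(** Every vertex is a complement of [T], a neighbour of [T], or [T] itself, and the last two classes
    are too small to matter. *)
Lemma vertices_le_complements : infinite_set (ig_vertices M) ->
  ~ (ig_vertices M #<= ig_neighbours T) -> ig_vertices M #<= complements.
Proof.
move=> Vinf VN.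
apply: (@card_le_setU_absorb _ _ _ _ [set T]) => //; last first.
  by move=> VT; apply: Vinf; exact: card_le_finite VT (finite_set1 _).
apply: (card_le_setU_absorb Vinf) VN; apply: subset_card_le => K VK.
have [->|TK] := pselect (K = T); first by left; right.
have [KT|KT] := pselect (is_zero [predI K & T]).
  by left; left; apply: maximal_complement => //; exact: VK.1.
right; split => //; split; first exact/nesym.
by move=> /is_zeroIP TK0; apply: KT; apply/is_zeroIP => x Kx Tx; exact: TK0.
Qed.

(** By the modular law [K + L] meets [T] exactly in [L]. It is therefore proper, and it differs from
    [T] because [K] is not contained in [T]. *)
Lemma add_complement_neighbour K L : complements K ->
  {subset L <= T} -> ~ is_zero L -> L <> T -> ig_neighbours T (add_submod K L).
Proof.
move=> CK LT L0 LneT; have /not_is_zeroP[l Ll l0] := L0.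
have addT x : x \in add_submod K L -> x \in T -> x \in L.
  move=> /add_submodP[k [l' [Kk Ll' ->]]] Tx.
  suff -> : k = 0 by rewrite add0r.
  apply: (complement_capT CK) => //.
  by rewrite -(addrK l' k); apply: submodB => //; exact: LT.
split; split.
- by apply/not_is_zeroP; exists l => //; exact: sub_add_submodr.
- move=> /is_fullP F; apply: LneT; apply: subset_submod_anti => // x.
  by apply: addT; exact: F.
- move=> e; have /simple_submodP[/not_is_zeroP[k Kk /eqP k0] _] :=
    maximal_complement_simple CK.
  by apply: k0; apply: (complement_capT CK) => //; rewrite e;
     exact: sub_add_submodl.
- move=> /is_zeroIP/(_ l (LT _ Ll) (sub_add_submodr _ Ll)) e.
  by rewrite e eqxx in l0.
Qed.

Lemma uniform_of_small_degree L L' : infinite_set (ig_vertices M) ->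
  ~ (ig_vertices M #<= ig_neighbours T) ->
  {subset L <= T} -> {subset L' <= T} -> ~ is_zero L -> ~ is_zero L' ->
  ~ is_zero [predI L & L'].
Proof.
move=> Vinf VN LT L'T L0 L'0 /is_zeroIP LL'; apply: (VN).
have LneT : L <> T.
  move=> e; apply: L'0; apply/is_zeroP => x L'x; apply: LL' => //.
  by rewrite e; exact: L'T.
have L'neT : L' <> T.
  move=> e; apply: L0; apply/is_zeroP => x Lx; apply: LL' => //.
  by rewrite e; exact: LT.
have CN : complements #<= ig_neighbours T `*` ig_neighbours T.
  apply: (@card_le_inj _ _ _ _ (fun K => (add_submod K L, add_submod K L'))).
    by move=> K CK; split; exact: add_complement_neighbour.
  suff sub K K' : complements K' -> add_submod K L = add_submod K' L ->
      add_submod K L' = add_submod K' L' -> {subset K <= K'}.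
    move=> K K' CK CK' e; have e1 := congr1 fst e; have e2 := congr1 snd e.
    by apply: subset_submod_anti; exact: sub.
  move=> CK' e e' x Kx.
  have : x \in add_submod K L by exact: sub_add_submodl.
  rewrite e => /add_submodP[k [l [Kk Ll xE]]].
  have : x \in add_submod K L' by exact: sub_add_submodl.
  rewrite e' => /add_submodP[k' [l' [Kk' Ll' xE']]].
  have Nl : - l \in T by apply/submodN/LT.
  have Nl' : - l' \in T by apply/submodN/L'T.
  (* Both [- l] and [- l'] move [x] into the complement [K'], so they agree; then [l] lies in [L]
     and in [L'], hence is zero and [x] belongs to [K']. *)
  have /oppr_inj ll' : - l = - l'.
    apply: (@complement_uniq K' x _ _ CK' Nl Nl').
      by rewrite xE addrK.
    by rewrite xE' addrK.
  suff l0 : l = 0 by rewrite xE l0 addr0.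
  by apply: LL' => //; rewrite ll'.
have VC : ig_vertices M #<= complements.
  exact: vertices_le_complements.
have VNN := card_le_trans VC CN.
(* A finite degree has a finite square, which cannot bound infinitely many vertices; an infinite
   degree absorbs its square. *)
have [Nfin|Ninf] := pselect (finite_set (ig_neighbours T)).
  by case: Vinf; apply: card_le_finite VNN _; exact: finite_setX.
exact: card_le_trans VNN (infinite_setX_le Ninf).
Qed.

End Complements.

(** * Comparison of the degree of [T] with the vertices of the quotient by [S'] *)

Section Quotient.
Variables (R : pzRingType) (M : lmodType R) (T S' : submodClosed M).
Implicit Type K : submodClosed M.
Hypotheses (simS' : simple_module (submod_type S')) (S'T : {subset S' <= T}).

(** Essentiality makes [S'] meet the intersection of [T] and [K], so the intersection of [S'] and
    [K] is a nonzero submodule of the simple [S']. *)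
Lemma sub_essential_simple K : essential_in S' T ->
  ~ is_zero [predI T & K] -> {subset S' <= K}.
Proof.
move=> [_ ess] TK.
have /is_zeroIP/existsNP[x] : ~ is_zero [predI S' & cap_submod T K].
  apply: ess => [x /cap_submodP[]//|/is_zeroP Z].
  by apply: TK; apply/is_zeroIP => x Tx Kx; apply: Z; exact/cap_submodP.
move=> /not_implyP[S'x /not_implyP[/cap_submodP[_ Kx] x0]].
have /simple_submodP[_ simS] := simS'.
have [||<-] := simS (cap_submod S' K); first by move=> y /cap_submodP[].
  by move=> /is_zeroP Z; case: x0; apply: Z; exact/cap_submodP.
by move=> y /cap_submodP[].
Qed.

(** Neighbours of [T] contain [S'], so they are determined by their images in the quotient. Only
    [S'] has zero image, and it is sent to the added point. *)
Lemma neighbours_le_quotient : essential_in S' T ->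
  ig_neighbours T #<= add_point (ig_vertices (quotmod S')).
Proof.
move=> ess.
have NS' K : ig_neighbours T K -> {subset S' <= K}.
  by move=> [_ [_ TK]]; exact: sub_essential_simple.
pose pi := quot_pi S'.
have piK K x : {subset S' <= K} -> (pi x \in im_submod pi K) = (x \in K).
  move=> S'K; apply/im_submodP/idP => [[y Ky /esym/quot_piE xy]|Kx].
    by rewrite -(subrK y x) rpredD//; exact: S'K.
  by exists x.
apply: (@card_le_inj _ _ _ _
  (fun K => if pselect (K = S') is left _ then None else Some (im_submod pi K))).
  move=> K NK; case: pselect => [_|KS']; [by left|right].
  have S'K := NS' _ NK; have [[K0 Kf] _] := NK.
  exists (im_submod pi K) => //; split.
    move=> /is_zeroP Z; apply: KS'; apply: subset_submod_anti => // x Kx.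
    by apply/quot_pi_eq0; apply: Z; apply/im_submodP; exists x.
  by move=> /is_fullP F; apply: Kf; apply/is_fullP => x; rewrite -piK.
move=> K K' /NS' S'K /NS' S'K'.
case: pselect => [->|_]; case: pselect => [->|_]// /Some_inj e.
by apply: submod_ext => x; rewrite -!piK// e.
Qed.

(** Preimages under the projection contain [S'], hence meet [T]; the added point goes to [S']. The
    singleton of [T] appears because [T] may be such a preimage while it is not its own
    neighbour. *)
Lemma quotient_le_neighbours : ~ is_full T ->
  add_point (ig_vertices (quotmod S')) #<= ig_neighbours T `|` [set T].
Proof.
move=> Tf; pose pi := quot_pi S'.
have /simple_submodP[S'0 _] := simS'.
have S'pre L : {subset S' <= preim_submod pi L}.
  by move=> x /quot_pi_eq0 x0; rewrite preim_submodP /= x0 rpred0.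
have preN K : {subset S' <= K} -> ~ is_full K ->
    (ig_neighbours T `|` [set T]) K.
  move=> S'K Kf; have [->|KT] := pselect (K = T); [by right|left].
  have /not_is_zeroP[x S'x /eqP x0] := S'0.
  split; split => //; [|exact/nesym|].
    by move=> /is_zeroP Z; apply: x0; apply: Z; exact: S'K.
  by move=> /is_zeroIP Z; apply: x0; apply: Z; [exact: S'T|exact: S'K].
have pre_zero L : preim_submod pi L = S' -> is_zero L.
  move=> e; apply/is_zeroP => q; have [x <-] := quot_pi_surj q => Lx.
  by apply/quot_pi_eq0; rewrite -e preim_submodP.
apply: (@card_le_inj _ _ _ _
  (fun o => if o is Some L then preim_submod pi L else S')).
  move=> _ [->|[L [_ Lf] <-]]; apply: preN => //.
    by move=> /is_fullP F; apply: Tf; apply/is_fullP => x; exact: S'T.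
  move=> /is_fullP F; apply: Lf; apply/is_fullP => q.
  by have [x <-] := quot_pi_surj q; rewrite -preim_submodP.
move=> _ _ [->|[L [L0 _] <-]] [->|[L' [L'0 _] <-]]//.
- by move=> /esym/pre_zero.
- by move=> /pre_zero.
- move=> e; congr Some; apply: submod_ext => q.
  by have [x <-] := quot_pi_surj q; rewrite -!(preim_submodP pi) e.
Qed.

End Quotient.

Theorem theorem2p2 (R : pzRingType) (M : lmodType R) (T : submodClosed M)
    (maxT : maximal_submod T) :
  (infinite_set (ig_vertices M) /\ card_lt (ig_neighbours T) (ig_vertices M))
  <->
  (exists S S' : submodClosed M,
    [/\ simple_module (submod_type S) /\ direct_sum S T,
        [/\ simple_module (submod_type S'), {subset S' <= T},
            essential_in S' T & module_iso (submod_type S) (submod_type S')],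
        card_eq (End_set (submod_type S)) (ig_vertices M) /\
          infinite_set (ig_vertices M)
      & card_lt (add_point (ig_vertices (quotmod S'))) (ig_vertices M)]).
Proof.
split=> [[Vinf [_ VN]]|]; last first.
  move=> [S [S' [_ [simS' S'T ess _] [_ Vinf] [_ VQ]]]]; split => //.
  apply: card_ltNge => VN; apply: VQ.
  by apply: card_le_trans VN _; exact: neighbours_le_quotient.
have VC := vertices_le_complements maxT Vinf VN.
(* The complements are infinite in number, so there are two distinct ones. *)
have [S [K [CS CK SK]]] : exists S K,
    [/\ complements T S, complements T K & S <> K].
  by apply: infinite_two => /(card_le_finite VC).
have simS := maximal_complement_simple maxT CS.
have [S' S'T iso] := complement_iso simS CS CK SK.
have simS' : simple_module (submod_type S').
  by case: iso => f fbij; exact: simple_module_iso fbij simS.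
have /simple_submodP[S0 _] := simS.
have /simple_submodP[S'0 _] := simS'.
have ess : essential_in S' T.
  split => // L LT L0.
  exact: uniform_of_small_degree maxT _ _ Vinf VN S'T LT S'0 L0.
have T0 : ~ is_zero T.
  move=> /is_zeroP Z; apply: S'0; apply/is_zeroP => x S'x.
  by apply: Z; exact: S'T.
exists S, S'; split => //.
  split => //; rewrite card_eq_le; apply/andP; split.
    exact: End_le_vertices CS S0 T0 S'T iso.
  exact: card_le_trans VC (complements_le_End CS simS ess iso).
(* Otherwise the vertices would be bounded by the neighbours of [T] together with [T] itself, and an
   infinite cardinal is unaffected by that single extra point. *)
apply: card_ltNge => VQ; apply: VN.
apply: (@card_le_setU_absorb _ _ _ _ [set T]) => //.
  exact: card_le_trans VQ (quotient_le_neighbours simS' S'T maxT.1).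
by move=> VT; apply: Vinf; exact: card_le_finite VT (finite_set1 _).
Qed.
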